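(* Let $p$ be a prime number. There is an equational proof that every $p^2$-ring with $p=0$ is commutative.
   Context: Rings are associative and unital, not necessarily commutative; the zero ring is allowed. For an integer $n>1$, an $n$-ring is a ring in which $x^n=x$ holds for every element $x$. Equational proofs. An algebraic theory $\mathcal{T}$ is given by operation symbols of finite arities and a set of axioms, each an equation between terms. An equational proof of $\sigma=\tau$ in $\mathcal{T}$ (written $\mathcal{T}\vdash\sigma=\tau$) is a deduction by the rules: (1) if $\sigma=\tau$ is an axiom then $\mathcal{T}\vdash\sigma=\tau$; (2) $\mathcal{T}\vdash\sigma=\sigma$; (3) if $\mathcal{T}\vdash\sigma=\tau$ then $\mathcal{T}\vdash\tau=\sigma$; (4) if $\mathcal{T}\vdash\sigma=\tau$ and $\mathcal{T}\vdash\tau=\rho$ then $\mathcal{T}\vdash\sigma=\rho$; (5) if $\rho$ is a term of arity $r$ and $\mathcal{T}\vdash\sigma_i=\tau_i$ for $i=1,\dots,r$, then $\mathcal{T}\vdash\rho(\sigma_1,\dots,\sigma_r)=\rho(\tau_1,\dots,\tau_r)$; (6) if $\sigma,\tau$ are terms of arity $r$ with $\mathcal{T}\vdash\sigma=\tau$, then $\mathcal{T}\vdash\sigma(\rho_1,\dots,\rho_r)=\tau(\rho_1,\dots,\rho_r)$ for all terms $\rho_1,\dots,\rho_r$. The theory of $p^2$-rings with $p=0$ consists of the ring axioms (operations $+,-,0,\cdot,1$) together with the axioms $x^{p^2}=x$ and $p\cdot 1=0$. ''There is an equational proof that every such ring is commutative'' means that this theory proves $xy=yx$ for two distinct variables $x,y$.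 *)

(* Defs.v *)
From mathcomp Require Import all_boot.

Set Implicit Arguments.
Unset Strict Implicit.
Unset Printing Implicit Defensive.

Record signature := Signature { op : Type; arity : op -> nat }.

(* Terms of arity r: their variables are indexed by 'I_r. *)
Inductive term (S : signature) (r : nat) : Type :=
| Var (i : 'I_r)
| App (f : op S) (a : 'I_(arity f) -> term S r).
Arguments Var {S r} i.
Arguments App {S r} f a.

(* subst t s is t(s_0, ..., s_{r-1}). *)
Fixpoint subst (S : signature) (r k : nat) (t : term S r)
    (s : 'I_r -> term S k) : term S k :=
  match t with
  | Var i => s i
  | App f a => App f (fun j => subst (a j) s)
  end.

(* T r s t means that s = t is an axiom, stated in r variables. *)
Definition theory (S : signature) := forall r, term S r -> term S r -> Prop.

Inductive provable (S : signature) (T : theory S) :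
    forall r, term S r -> term S r -> Prop :=
| prov_axiom r (s t : term S r) : T r s t -> provable T s t
| prov_refl r (s : term S r) : provable T s s
| prov_sym r (s t : term S r) : provable T s t -> provable T t s
| prov_trans r (s t u : term S r) :
    provable T s t -> provable T t u -> provable T s u
| prov_congr r k (u : term S r) (s t : 'I_r -> term S k) :
    (forall i, provable T (s i) (t i)) -> provable T (subst u s) (subst u t)
| prov_subst r k (s t : term S r) (u : 'I_r -> term S k) :
    provable T s t -> provable T (subst s u) (subst t u).

Inductive ring_op := AddOp | OppOp | ZeroOp | MulOp | OneOp.

Definition ring_arity (f : ring_op) : nat :=
  match f with
  | AddOp | MulOp => 2
  | OppOp => 1
  | ZeroOp | OneOp => 0
  end.

Definition ring_sig : signature := Signature ring_arity.

Notation ring_term := (term ring_sig).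

Definition tadd r (s t : ring_term r) : ring_term r :=
  @App ring_sig r AddOp (tnth [tuple s; t]).
Definition topp r (s : ring_term r) : ring_term r :=
  @App ring_sig r OppOp (tnth [tuple s]).
Definition tzero r : ring_term r := @App ring_sig r ZeroOp (tnth [tuple]).
Definition tmul r (s t : ring_term r) : ring_term r :=
  @App ring_sig r MulOp (tnth [tuple s; t]).
Definition tone r : ring_term r := @App ring_sig r OneOp (tnth [tuple]).

Declare Scope ring_term_scope.
Delimit Scope ring_term_scope with RT.
Bind Scope ring_term_scope with term.
Notation "s + t" := (tadd s t) : ring_term_scope.
Notation "- s" := (topp s) : ring_term_scope.
Notation "s * t" := (tmul s t) : ring_term_scope.
Notation "0" := (tzero _) : ring_term_scope.
Notation "1" := (tone _) : ring_term_scope.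

(* Right-nested, as GRing.exp and GRing.natmul: t ^ 3 is t * (t * t), and
   t ^ 1 is t itself. *)
Definition texp r (t : ring_term r) (n : nat) : ring_term r :=
  iterop n (@tmul r) t (tone r).
Definition tmuln r (t : ring_term r) (n : nat) : ring_term r :=
  iterop n (@tadd r) t (tzero r).

Definition tvar r (i : nat) (ltir : i < r) : ring_term r :=
  Var (Ordinal ltir).

Notation "''x' [ r ]" := (@tvar r 0 isT) (format "''x' [ r ]").
Notation "''y' [ r ]" := (@tvar r 1 isT) (format "''y' [ r ]").
Notation "''z' [ r ]" := (@tvar r 2 isT) (format "''z' [ r ]").

Local Open Scope ring_term_scope.

Inductive ring_theory : theory ring_sig :=
| ax_addA : ring_theory ('x[3] + ('y[3] + 'z[3])) ('x[3] + 'y[3] + 'z[3])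
| ax_addC : ring_theory ('x[2] + 'y[2]) ('y[2] + 'x[2])
| ax_add0 : ring_theory (0 + 'x[1]) 'x[1]
| ax_addN : ring_theory (- 'x[1] + 'x[1]) 0
| ax_mulA : ring_theory ('x[3] * ('y[3] * 'z[3])) ('x[3] * 'y[3] * 'z[3])
| ax_mul1l : ring_theory (1 * 'x[1]) 'x[1]
| ax_mul1r : ring_theory ('x[1] * 1) 'x[1]
| ax_mulDl :
    ring_theory (('x[3] + 'y[3]) * 'z[3]) ('x[3] * 'z[3] + 'y[3] * 'z[3])
| ax_mulDr :
    ring_theory ('x[3] * ('y[3] + 'z[3])) ('x[3] * 'y[3] + 'x[3] * 'z[3]).

(* The theory of n-rings in which m = 0. *)
Inductive nring_theory (n m : nat) : theory ring_sig :=
| ax_ring r (s t : ring_term r) : ring_theory s t -> nring_theory n m s t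
| ax_exp : nring_theory n m (texp 'x[1] n) 'x[1]
| ax_char : nring_theory n m (tmuln (1 : ring_term 0) m) 0.

(* Main.v *)
(* An equation is provable iff it holds in the ring of terms modulo provable
   equality, so it suffices to show that a ring R with p = 0 and x^(p^2) = x is
   commutative. R is reduced, so its idempotents are central, and hence so are
   the x with x^p = x, in particular x + x^p and x x^p for every x. Therefore
   c = [x, y] satisfies c x = x^p c. For odd p, the trace z + z^p annihilates c
   for z = c and for z = (x + k) c, k in F_p, which together say that the norm
   (x + k)(x^p + k) behaves like a nonzero square in F_p for every k. But
   ((x + T)(x^p + T))^((p-1)/2) - 1 has degree p - 1 in T, so it cannot vanish
   at all p values of k unless (x - x^p) c = 0. Finally (x - x^p) c = 0
   forces c = 0, by cutting with the idempotent 1 - (x - x^p)^(p^2 - 1). *)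
Require Import Defs.
From HB Require Import structures.
From mathcomp Require Import all_boot all_algebra.
From mathcomp Require Import generic_quotient boolp zify.

Set Implicit Arguments.
Unset Strict Implicit.
Unset Printing Implicit Defensive.

Import GRing.Theory.

Local Open Scope ring_scope.
Local Open Scope quotient_scope.

(** * Polynomials over a noncommutative ring of characteristic p *)

Lemma coef_size_prod_XsubC (R : nzRingType) (s : seq R) :
  (\prod_(a <- s) ('X - a%:P))`_(size s) = 1.
Proof.
have /monicP := monic_prod_XsubC s xpredT (fun a : R => a).
by rewrite /lead_coef size_prod_XsubC.
Qed.

Lemma coef_pred_size_prod_XsubC (R : nzRingType) (s : seq R) :
  (0 < size s)%N ->
  (\prod_(a <- s) ('X - a%:P))`_(size s).-1 = - \sum_(a <- s) a.
Proof.
elim: s => // a [|b s] IHs _.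
  by rewrite !big_seq1 coefB coefX coefC sub0r.
rewrite [in LHS]big_cons [in RHS]big_cons mulrBl coefB coefXM coefCM.
by rewrite coef_size_prod_XsubC mulr1 IHs // opprD addrC.
Qed.

Section CharacteristicP.
Variables (R : nzRingType) (p : nat).
Hypothesis pcharRp : p \in [pchar R].

(** By Bezout, [d] is invertible modulo [p]. *)
Lemma mulr_natr_pchar_eq0 (a : R) d :
  (0 < d < p)%N -> a * d%:R = 0 -> a = 0.
Proof.
move=> /andP[d_gt0 ltdp] ad0; have prp := pcharf_prime pcharRp.
case: (egcdnP p d_gt0) => u v def_ud _.
have /eqP gcd1: coprime d p by rewrite coprime_sym prime_coprime // gtnNdvd.
have: a * d%:R * u%:R = 0 by rewrite ad0 mul0r.
rewrite -mulrA -natrM mulnC def_ud gcd1 natrD natrM (pcharf0 pcharRp).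
by rewrite mulr0 add0r mulr1.
Qed.

(** Over a noncommutative ring evaluation need not be multiplicative; it is at [k%:R], which
    commutes with every coefficient. *)
Lemma hornerM_nat (f g : {poly R}) k :
  (f * g).[k%:R] = f.[k%:R] * g.[k%:R].
Proof. by apply: hornerM_comm; rewrite /comm_poly -commr_nat. Qed.

Lemma hornerX_nat (f : {poly R}) n k : (f ^+ n).[k%:R] = f.[k%:R] ^+ n.
Proof.
by elim: n => [|n IHn]; rewrite ?hornerC // !exprS hornerM_nat IHn.
Qed.

(** Although [R] may have zero divisors, differences of the points [k%:R] can be cancelled, so
    linear factors split off one at a time. *)
Lemma poly_nat_roots_eq0 n (f : {poly R}) :
    (n <= p)%N -> (size f <= n)%N ->
  (forall k, (k < n)%N -> f.[k%:R] = 0) -> f = 0.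
Proof.
elim: n f => [|n IHn] f len szf f0; first by apply/eqP; rewrite -size_poly_leq0.
have /factor_theorem[q def_f]: root f n%:R by apply/eqP; exact: f0.
suff q0: q = 0 by rewrite def_f q0 mul0r.
apply: IHn => [||k ltkn]; first exact: ltnW.
  have [-> | nzq] := eqVneq q 0; first by rewrite size_poly0.
  by move: szf; rewrite def_f size_Mmonic ?monicXsubC // size_XsubC; lia.
have := f0 k (ltnW ltkn); rewrite def_f hornerM_nat hornerXsubC.
rewrite -opprB mulrN -natrB 1?ltnW // => /eqP; rewrite oppr_eq0 => /eqP.
by apply: mulr_natr_pchar_eq0; lia.
Qed.

Lemma mulrn_pred_pchar (x : R) : x *+ p.-1 = - x.
Proof.
apply/eqP; rewrite -subr_eq0 opprK -mulrSr prednK ?mulrn_pchar //.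
exact/prime_gt0/(pcharf_prime pcharRp).
Qed.

Lemma natr_exp_pchar k : k%:R ^+ p = k%:R :> R.
Proof. by rewrite -[LHS](pFrobenius_autE pcharRp) pFrobenius_aut_nat. Qed.

Lemma exprD_pchar_comm (x y : R) :
  GRing.comm x y -> (x + y) ^+ p = x ^+ p + y ^+ p.
Proof.
by move=> cxy; rewrite -!(pFrobenius_autE pcharRp) pFrobenius_autD_comm.
Qed.

Lemma exprB_pchar_comm (x y : R) :
  GRing.comm x y -> (x - y) ^+ p = x ^+ p - y ^+ p.
Proof.
by move=> cxy; rewrite -!(pFrobenius_autE pcharRp) pFrobenius_autB_comm.
Qed.

End CharacteristicP.

Lemma intertwine_exp (R : pzSemiRingType) (a b d : R) n :
  d * a = b * d -> d * a ^+ n = b ^+ n * d.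
Proof.
move=> da; elim: n => [|n IHn]; first by rewrite mulr1 mul1r.
by rewrite !exprSr mulrA IHn -!mulrA da.
Qed.

(** * Reducedness, central elements and commutators *)

Definition central (R : pzSemiRingType) (a : R) := forall b, GRing.comm a b.

Section PSquareRing.
Variables (R : nzRingType) (p : nat).
Hypothesis pcharRp : p \in [pchar R].
Hypothesis expRp2 : forall x : R, x ^+ (p ^ 2) = x.

Let prp : prime p := pcharf_prime pcharRp.
Let p_gt1 : (1 < p)%N := prime_gt1 prp.

Lemma sqr_eq0 (x : R) : x * x = 0 -> x = 0.
Proof.
move=> x2; rewrite -(expRp2 x); have [q ->]: {q | (p ^ 2 = q.+2)%N}.
  by exists (p ^ 2 - 2)%N; nia.
by rewrite !exprS mulrA x2 mul0r.
Qed.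

Lemma mul_eq0_comm (x y : R) : x * y = 0 -> y * x = 0.
Proof.
by move=> xy0; apply: sqr_eq0; rewrite mulrA -(mulrA y) xy0 mulr0 mul0r.
Qed.

(** Both [e * y * (1 - e)] and [(1 - e) * y * e] square to zero, hence vanish, so
    [e * y = e * y * e = y * e]. *)
Lemma idempotent_central (e : R) : e * e = e -> central e.
Proof.
move=> ee y; have e1: (1 - e) * e = 0 by rewrite mulrBl mul1r ee subrr.
have e2: e * (1 - e) = 0 by rewrite mulrBr mulr1 ee subrr.
have: e * y * (1 - e) = 0.
  by apply: sqr_eq0; rewrite !mulrA -(mulrA (e * y)) e1 mulr0 !mul0r.
have: (1 - e) * y * e = 0.
  by apply: sqr_eq0; rewrite !mulrA -(mulrA (_ * y)) e2 mulr0 !mul0r.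
rewrite mulrBr mulr1 !mulrBl mul1r => /subr0_eq ye /subr0_eq ey.
by rewrite /GRing.comm ye.
Qed.

Lemma frobenius_fixed_exp_idempotent (x : R) :
  x ^+ p = x -> x ^+ p.-1 * x ^+ p.-1 = x ^+ p.-1.
Proof.
move=> xp; rewrite -exprD; have -> : (p.-1 + p.-1 = p + (p - 2))%N by lia.
by rewrite exprD xp -exprS; congr (_ ^+ _); lia.
Qed.

(* Each x - k is also fixed by Frobenius, so (x - k)^(p-1) is idempotent, hence
   central, for every k < p; comparing coefficients in k, so is x. *)
Lemma frobenius_fixed_central (x : R) : x ^+ p = x -> central x.
Proof.
move=> xp y.
pose s := nseq p.-1 x.
pose f := \prod_(a <- s) ('X - a%:P).
have fE: f = ('X - x%:P) ^+ p.-1 by rewrite /f big_nseq iter_mulr_1.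
have szs: size s = p.-1 by rewrite size_nseq.
have szf: size f = p by rewrite size_prod_XsubC szs; lia.
have fy: f * y%:P - y%:P * f = 0.
  apply: (poly_nat_roots_eq0 pcharRp (leqnn p)) => [|k _].
    apply/leq_sizeP => j lepj.
    by rewrite coefB coefMC coefCM nth_default ?szf // mul0r mulr0 subrr.
  rewrite hornerD hornerN !hornerM_nat hornerC fE hornerX_nat hornerXsubC.
  apply/eqP; rewrite subr_eq0; apply/eqP; apply: idempotent_central.
  apply: frobenius_fixed_exp_idempotent.
  rewrite (exprB_pchar_comm pcharRp) ?natr_exp_pchar ?xp //.
  exact/commr_sym/commr_nat.
(* In degree [p - 2] the coefficient of [f] is [- (x *+ p.-1) = x], which leaves [x * y - y * x]. *)
have: (f * y%:P - y%:P * f)`_(size s).-1 = 0 by rewrite fy coef0.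
rewrite coefB coefMC coefCM coef_pred_size_prod_XsubC; last by rewrite szs; lia.
rewrite big_nseq iter_addr_0 mulrN (mulrn_pred_pchar pcharRp).
rewrite !mulNr mulrN !opprK.
by move/eqP; rewrite subr_eq0 => /eqP.
Qed.

Lemma exprpp (x : R) : (x ^+ p) ^+ p = x.
Proof. by rewrite -exprM expRp2. Qed.

Lemma trace_central (x : R) : central (x + x ^+ p).
Proof.
apply: frobenius_fixed_central.
by rewrite (exprD_pchar_comm pcharRp) ?exprpp 1?addrC //; apply: commrX.
Qed.

Lemma norm_central (x : R) : central (x * x ^+ p).
Proof.
apply: frobenius_fixed_central.
by rewrite exprMn_comm ?exprpp; [rewrite -exprSr exprS | apply: commrX].
Qed.

(** Here [(a * x) ^+ p = a * x ^+ p = a * x], so [a * x] is central along with [a]. *)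
Lemma commutator_scale_eq0 (a x y : R) :
  central a -> a ^+ p = a -> a * x = a * x ^+ p -> a * (x * y - y * x) = 0.
Proof.
move=> ca ap ax; have: central (a * x).
  by apply: frobenius_fixed_central; rewrite exprMn_comm // ap.
move=> /(_ y); rewrite /GRing.comm => axy.
by rewrite mulrBr mulrA axy mulrA -ca -mulrA subrr.
Qed.

(* x^2 - t x + n = 0 with t = x + x^p and n = x x^p central, so that
   x c + c x = [x^2, y] = t c for c = [x, y]. *)
Lemma commutator_conj (x y : R) :
  (x * y - y * x) * x = x ^+ p * (x * y - y * x).
Proof.
set c := x * y - y * x.
have tc: (x + x ^+ p) * c = x * x * y - y * (x * x).
  have tx: (x + x ^+ p) * x = x * x + x * x ^+ p.
    by rewrite mulrDl -exprSr exprS.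
  rewrite mulrBr !mulrA (trace_central x y) -(mulrA y (x + _)) tx mulrDl mulrDr.
  by rewrite (norm_central x y) opprD addrACA subrr addr0 mulrA.
apply: (addrI (x * c)); rewrite -mulrDl tc.
by rewrite mulrBr mulrBl !mulrA addrA subrK.
Qed.

(** For [w = x - x ^+ p], the idempotent [f = w ^+ (p ^ 2 - 1)] kills [c] because [w] does. Its
    complement [1 - f] kills [w], hence also [c] by [commutator_scale_eq0]. *)
Lemma commutator_eq0 (x y : R) :
  x * (x * y - y * x) = x ^+ p * (x * y - y * x) -> x * y - y * x = 0.
Proof.
set c := _ - _ => xc; pose w := x - x ^+ p.
have [q pq]: {q | (p ^ 2 = q.+2)%N} by exists (p ^ 2 - 2)%N; nia.
have wq: w ^+ q.+2 = w by rewrite -pq.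
pose f := w ^+ q.+1.
have ff: f * f = f by rewrite /f -exprD addnS -addSn exprD wq -exprS.
have fc: f * c = 0 by rewrite /f exprSr -mulrA mulrBl xc subrr mulr0.
have gg: (1 - f) * (1 - f) = 1 - f.
  by rewrite mulrBr mulr1 mulrBl mul1r ff subrr subr0.
have gc: (1 - f) * c = 0.
  apply: commutator_scale_eq0; first exact: idempotent_central.
    rewrite -(prednK (ltnW p_gt1)); elim: p.-1 => // n IHn.
    by rewrite exprS IHn.
  apply/eqP; rewrite -subr_eq0 -mulrBr -/w mulrBl mul1r.
  by rewrite /f -exprSr wq subrr.
by move: gc; rewrite mulrBl mul1r fc subr0.
Qed.

(** * Odd characteristic *)

Section OddCharacteristic.
Variable h : nat.
Hypothesis p_odd : p = h.*2.+1.

(** Since [d * d] commutes with [x], the odd power [d ^+ p] intertwines [x] and [x ^+ p] as [d]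
    does. The central element [d + d ^+ p] therefore has equal products with [x] and [x ^+ p]. *)
Lemma trace_mul_commutator_eq0 (x y d : R) :
  d * x = x ^+ p * d -> (d + d ^+ p) * (x * y - y * x) = 0.
Proof.
move=> dx.
have dxp: d * x ^+ p = x * d.
  by rewrite (intertwine_exp p dx) exprpp.
have ddx: GRing.comm x (d * d).
  by rewrite /GRing.comm mulrA -dxp -!mulrA dx.
have dpx: d ^+ p * x = x ^+ p * d ^+ p.
  have -> : d ^+ p = d * (d * d) ^+ h.
    by rewrite {1}p_odd -addnn exprS exprD -exprMn_comm.
  by rewrite -mulrA -(commrX h ddx) [RHS]mulrA -dx mulrA.
apply: commutator_scale_eq0; first exact: trace_central.
  by rewrite (exprD_pchar_comm pcharRp) ?exprpp 1?addrC //; apply: commrX.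
by rewrite (trace_central d (x ^+ p)) mulrDl mulrDr dx dpx.
Qed.

(* With u = k + x and v = u^p = k + x^p one has c u = v c, so that
   (u c)^2 = u v c^2 and (u c)^p = u^(h+1) v^h c^p; trace_mul_commutator_eq0
   for d = c and d = u c gives c^p c = - c c and (u c)^p c = - u c c. *)
Lemma commutator_shift_norm (x y : R) (k : nat) (c := x * y - y * x) :
  (k%:R + x - (k%:R + x) ^+ h.+1 * (k%:R + x ^+ p) ^+ h) * (c * c) = 0.
Proof.
set u := k%:R + x; set v := k%:R + x ^+ p.
have cx: c * x = x ^+ p * c := commutator_conj x y.
have cxp: c * x ^+ p = x * c.
  by rewrite (intertwine_exp p cx) exprpp.
have cu: c * u = v * c by rewrite (mulrDr c) (mulrDl _ _ c) cx (commr_nat c).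
have cv: c * v = u * c by rewrite (mulrDr c) (mulrDl _ _ c) cxp (commr_nat c).
have cxu: GRing.comm x u.
  by apply: commrD => //; apply: commr_nat.
have cuv: GRing.comm u v.
  by apply: commrD; [apply: commr_nat | apply/commrX/commr_sym].
have ccu: GRing.comm u (c * c) by rewrite /GRing.comm mulrA -cv -!mulrA cu.
have ccv: GRing.comm v (c * c) by rewrite /GRing.comm mulrA -cu -!mulrA cv.
have cpc: c ^+ p * c = - (c * c).
  have /eqP := trace_mul_commutator_eq0 y cx.
  by rewrite mulrDl addrC addr_eq0 => /eqP.
have dx: (u * c) * x = x ^+ p * (u * c).
  rewrite -mulrA cx !mulrA; congr (_ * c).
  exact: commrX (commr_sym cxu).
have dp: (u * c) ^+ p = u ^+ h.+1 * v ^+ h * c ^+ p.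
  have -> : (u * c) ^+ p = (u * v * (c * c)) ^+ h * (u * c).
    rewrite {1}p_odd -addnn exprSr exprD -exprMn_comm //; congr (_ ^+ h * _).
    by rewrite mulrA -(mulrA u) cu !mulrA.
  have -> : c ^+ p = (c * c) ^+ h * c.
    by rewrite {1}p_odd -addnn exprSr exprD -exprMn_comm.
  rewrite exprMn_comm; last by apply/commr_sym/commrM; apply/commr_sym.
  rewrite exprMn_comm // -(mulrA _ _ (u * c)) (mulrA _ u c) -(commrX h ccu).
  rewrite -(mulrA u) mulrA -(mulrA _ _ u) -(commrX h cuv) (mulrA _ u).
  by rewrite -exprSr.
have := trace_mul_commutator_eq0 y dx; rewrite -/c mulrDl dp -mulrA.
by rewrite -[_ * c ^+ p * c]mulrA cpc mulrN -mulrBl.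
Qed.

(* As a polynomial in k, the left factor in commutator_shift_norm has leading
   term - k^p. Adding k^p - k, which vanishes for all k < p, leaves a
   polynomial of degree at most p - 1 with p roots, whose coefficient of
   k^(p-1) is a multiple of (x - x^p) c^2. *)
Lemma commutator_eq0_odd (x y : R) : x * y - y * x = 0.
Proof.
have h_gt0 : (0 < h)%N by lia.
set c := x * y - y * x.
pose s := nseq h.+1 (- x) ++ nseq h (- x ^+ p).
pose P := \prod_(a <- s) ('X - a%:P).
pose f := 'X - (- x)%:P - P + ('X^p - 'X).
have szs : size s = p by rewrite size_cat !size_nseq p_odd; lia.
have PE : P = ('X - (- x)%:P) ^+ h.+1 * ('X - (- x ^+ p)%:P) ^+ h.
  by rewrite /P big_cat !big_nseq !iter_mulr_1.
have fcc : f * (c * c)%:P = 0.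
  apply: (poly_nat_roots_eq0 pcharRp (leqnn p)) => [|k _].
    apply/leq_sizeP => j lepj; rewrite coefMC.
    suff -> : f`_j = 0 by rewrite mul0r.
    rewrite !(coefD, coefN) coefXn coefX coefC.
    have -> : (j == 1)%N = false by lia.
    have -> : (j == 0)%N = false by lia.
    rewrite subr0 !sub0r subr0; have [-> | neqjp] := eqVneq j p.
      by rewrite -{1}szs coef_size_prod_XsubC addNr.
    rewrite nth_default ?oppr0 ?addr0 // size_prod_XsubC szs ltn_neqAle.
    by rewrite eq_sym neqjp.
  rewrite hornerM_nat hornerC !(hornerD, hornerN) PE hornerM_nat !hornerX_nat.
  rewrite !hornerXsubC hornerC !opprK hornerX natr_exp_pchar // subrr addr0.
  exact: commutator_shift_norm.
have xcc : (x - x ^+ p) * (c * c) = 0.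
  have : (f * (c * c)%:P)`_p.-1 = 0 by rewrite fcc coef0.
  rewrite coefMC !(coefD, coefN) coefXn coefX coefC.
  (* As [p >= 3], only [P] contributes in degree [p - 1]. *)
  have -> : (p.-1 == p)%N = false by lia.
  have -> : (p.-1 == 1)%N = false by lia.
  have -> : (p.-1 == 0)%N = false by lia.
  rewrite -{1}szs coef_pred_size_prod_XsubC ?szs; last by lia.
  rewrite big_cat !big_nseq !iter_addr_0 /=.
  set S := (X in X * _ = 0 -> _) => Scc.
  (* [S] is minus the sum of [x *+ h.+1] and [x ^+ p *+ h]; doubling turns the multiplicities into
     [p + 1] and [p - 1], that is 1 and -1 in [R]. *)
  suff -> : x - x ^+ p = - (S *+ 2) by rewrite mulNr mulrnAl Scc mul0rn oppr0.
  rewrite /S !subr0 addr0 sub0r opprK mulrnDl -!mulrnA.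
  have -> : (h.+1 * 2 = p.+1)%N by lia.
  have -> : (h * 2 = p.-1)%N by lia.
  rewrite mulrS (mulrn_pchar pcharRp) (mulrn_pred_pchar pcharRp) addr0 opprK.
  by rewrite opprD opprK.
(* Reducedness removes one factor [c]: with [w = x - x ^+ p], [w * c * c = 0] gives
   [c * (w * c) = 0], so [w * c] squares to zero. *)
apply: commutator_eq0; apply/eqP; rewrite -subr_eq0 -mulrBl; apply/eqP.
apply: sqr_eq0; rewrite -mulrA [c * _]mul_eq0_comm ?mulr0 //.
by rewrite -mulrA.
Qed.

End OddCharacteristic.

(** * Characteristic two, and the conclusion for rings *)

Lemma commutator_eq0_char2 (x y : R) : p = 2 -> x * y - y * x = 0.
Proof.
move=> p2; have char2 : 2 \in [pchar R] by rewrite -p2.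
set c := x * y - y * x.
(* The cross terms of [(x + y) ^+ 2] add up to [c], so [c] is a combination of central traces. *)
have cE : x + y + (x + y) ^+ p = x + x ^+ p + (y + y ^+ p) + c.
  rewrite /c (oppr_pchar2 char2) p2 !expr2 mulrDl !mulrDr -/c !addrA.
  by rewrite [LHS](ACl (1*3*2*6*4*5)).
have xc : GRing.comm x c.
  have -> : c = x + y + (x + y) ^+ p - (x + x ^+ p + (y + y ^+ p)).
    by rewrite cE addrC addKr.
  by apply: commrB; [|apply: commrD]; apply/commr_sym/trace_central.
by apply: commutator_eq0; rewrite -/c xc -commutator_conj.
Qed.

End PSquareRing.

Theorem pchar_exp_sqr_commutative (R : nzRingType) (p : nat) :
    p \in [pchar R] -> (forall x : R, x ^+ (p ^ 2) = x) ->
  forall x y : R, x * y = y * x.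
Proof.
move=> pcharRp expRp2 x y; apply/eqP; rewrite -subr_eq0; apply/eqP.
have [p2 | p_odd] := even_prime (pcharf_prime pcharRp).
  exact: (commutator_eq0_char2 pcharRp expRp2).
apply: (commutator_eq0_odd pcharRp expRp2 (h := p./2)).
by rewrite -[LHS]odd_double_half p_odd.
Qed.

(** * Substitution in ring terms *)

Section SubstRing.
Variables (r k : nat) (u : 'I_r -> ring_term k).

(** The arguments of [App] form a function, and the two sides agree only pointwise; hence
    [funext]. *)
Lemma subst_tadd (s t : ring_term r) :
  subst (s + t)%RT u = (subst s u + subst t u)%RT.
Proof.
congr App; apply: funext => -[[|[|//]] i] /=.
  by rewrite !(tnth_nth s, tnth_nth (subst s u)).
by rewrite !(tnth_nth s, tnth_nth (subst s u)).
Qed.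

Lemma subst_tmul (s t : ring_term r) :
  subst (s * t)%RT u = (subst s u * subst t u)%RT.
Proof.
congr App; apply: funext => -[[|[|//]] i] /=.
  by rewrite !(tnth_nth s, tnth_nth (subst s u)).
by rewrite !(tnth_nth s, tnth_nth (subst s u)).
Qed.

Lemma subst_topp (s : ring_term r) : subst (- s)%RT u = (- subst s u)%RT.
Proof.
congr App; apply: funext => -[[|//] i] /=.
by rewrite !(tnth_nth s, tnth_nth (subst s u)).
Qed.

Lemma subst_tzero : subst (0 : ring_term r) u = 0%RT.
Proof. by congr App; apply: funext => -[]. Qed.

Lemma subst_tone : subst (1 : ring_term r) u = 1%RT.
Proof. by congr App; apply: funext => -[]. Qed.

Lemma subst_texp (s : ring_term r) n : subst (texp s n) u = texp (subst s u) n.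
Proof.
case: n => [|n]; first exact: subst_tone.
by rewrite /texp !iteropS; elim: n => // n IHn; rewrite !iterS subst_tmul IHn.
Qed.

Lemma subst_tmuln (s : ring_term r) n :
  subst (tmuln s n) u = tmuln (subst s u) n.
Proof.
case: n => [|n]; first exact: subst_tzero.
by rewrite /tmuln !iteropS; elim: n => // n IHn; rewrite !iterS subst_tadd IHn.
Qed.

End SubstRing.

(** * The ring of terms modulo provable equality *)

Section FreeRing.
Variables n m r : nat.
Local Notation T := (nring_theory n m).
Implicit Types s t : ring_term r.

Definition subst_ringE :=
  (subst_tadd, subst_tmul, subst_topp, subst_tzero, subst_tone, subst_texp,
   subst_tmuln).

Lemma provable_tadd s s' t t' :
  provable T s s' -> provable T t t' -> provable T (s + t)%RT (s' + t')%RT.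
Proof.
move=> ss' tt'.
have := @prov_congr _ T 2 r ('x[2] + 'y[2])%RT
  (tnth [tuple s; t]) (tnth [tuple s'; t']).
by rewrite !subst_ringE; apply=> -[[|[|//]] i]; rewrite !(tnth_nth s).
Qed.

Lemma provable_tmul s s' t t' :
  provable T s s' -> provable T t t' -> provable T (s * t)%RT (s' * t')%RT.
Proof.
move=> ss' tt'.
have := @prov_congr _ T 2 r ('x[2] * 'y[2])%RT
  (tnth [tuple s; t]) (tnth [tuple s'; t']).
by rewrite !subst_ringE; apply=> -[[|[|//]] i]; rewrite !(tnth_nth s).
Qed.

Lemma provable_topp s s' : provable T s s' -> provable T (- s)%RT (- s')%RT.
Proof.
move=> ss'.
have := @prov_congr _ T 1 r (- 'x[1])%RT (fun=> s) (fun=> s').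
by rewrite !subst_ringE; apply.
Qed.

(** The quotient needs a boolean relation on a choice type; classical logic supplies both, the
    latter as [{classic ring_term r}]. *)
Definition provableb s t := `[< provable T s t >].

Lemma provableb_refl : reflexive provableb.
Proof. by move=> s; apply/asboolP/prov_refl. Qed.

Lemma provableb_sym : symmetric provableb.
Proof. by move=> s t; apply/asboolP/asboolP; apply: prov_sym. Qed.

Lemma provableb_trans : transitive provableb.
Proof.
by move=> s t u /asboolP ts /asboolP su; apply/asboolP/(prov_trans ts su).
Qed.

Canonical provable_equiv :=
  EquivRel (provableb : rel {classic ring_term r})
    provableb_refl provableb_sym provableb_trans.

Definition free_nring := {eq_quot provable_equiv}.

HB.instance Definition _ := Choice.on free_nring.

Definition class s : free_nring := \pi_free_nring (s : {classic ring_term r}).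

Lemma classP s t : class s = class t <-> provable T s t.
Proof. by split => [/eqmodP/asboolP | st]; [|apply/eqmodP/asboolP]. Qed.

Lemma classK (a : free_nring) : class (repr a) = a.
Proof. exact: reprK. Qed.

Definition free_add (a b : free_nring) := class (repr a + repr b)%RT.
Definition free_mul (a b : free_nring) := class (repr a * repr b)%RT.
Definition free_opp (a : free_nring) := class (- repr a)%RT.

Lemma repr_class s : provable T (repr (class s)) s.
Proof. by apply/classP; rewrite classK. Qed.

Lemma class_add s t : class (s + t)%RT = free_add (class s) (class t).
Proof. by apply/classP/provable_tadd; apply/prov_sym/repr_class. Qed.

Lemma class_mul s t : class (s * t)%RT = free_mul (class s) (class t).
Proof. by apply/classP/provable_tmul; apply/prov_sym/repr_class. Qed.

Lemma class_opp s : class (- s)%RT = free_opp (class s).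
Proof. exact/classP/provable_topp/prov_sym/repr_class. Qed.

Definition classE := (class_add, class_mul, class_opp).

Lemma class_axiom k (s t : ring_term k) (u : 'I_k -> ring_term r) :
  nring_theory n m s t -> class (subst s u) = class (subst t u).
Proof. by move=> st; apply/classP/prov_subst/prov_axiom. Qed.

(** Instantiating the variables by representatives turns each axiom into a law for arbitrary
    classes. *)
Lemma class_ring_axiom k (s t : ring_term k) (u : 'I_k -> free_nring) :
  ring_theory s t ->
  class (subst s (repr \o u)) = class (subst t (repr \o u)).
Proof. by move/(ax_ring n m)/class_axiom. Qed.

Lemma free_addA : associative free_add.
Proof.
move=> a b c; have := class_ring_axiom (tnth [tuple a; b; c]) ax_addA.
by rewrite !subst_ringE !classE /= !(tnth_nth a) /= !classK.
Qed.

Lemma free_addC : commutative free_add.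
Proof.
move=> a b; have := class_ring_axiom (tnth [tuple a; b]) ax_addC.
by rewrite !subst_ringE !classE /= !(tnth_nth a) /= !classK.
Qed.

Lemma free_add0 : left_id (class 0%RT) free_add.
Proof.
move=> a; have := class_ring_axiom (tnth [tuple a]) ax_add0.
by rewrite !subst_ringE !classE /= !(tnth_nth a) /= !classK.
Qed.

Lemma free_addN : left_inverse (class 0%RT) free_opp free_add.
Proof.
move=> a; have := class_ring_axiom (tnth [tuple a]) ax_addN.
by rewrite !subst_ringE !classE /= !(tnth_nth a) /= !classK.
Qed.

Lemma free_mulA : associative free_mul.
Proof.
move=> a b c; have := class_ring_axiom (tnth [tuple a; b; c]) ax_mulA.
by rewrite !subst_ringE !classE /= !(tnth_nth a) /= !classK.
Qed.

Lemma free_mul1l : left_id (class 1%RT) free_mul.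
Proof.
move=> a; have := class_ring_axiom (tnth [tuple a]) ax_mul1l.
by rewrite !subst_ringE !classE /= !(tnth_nth a) /= !classK.
Qed.

Lemma free_mul1r : right_id (class 1%RT) free_mul.
Proof.
move=> a; have := class_ring_axiom (tnth [tuple a]) ax_mul1r.
by rewrite !subst_ringE !classE /= !(tnth_nth a) /= !classK.
Qed.

Lemma free_mulDl : left_distributive free_mul free_add.
Proof.
move=> a b c; have := class_ring_axiom (tnth [tuple a; b; c]) ax_mulDl.
by rewrite !subst_ringE !classE /= !(tnth_nth a) /= !classK.
Qed.

Lemma free_mulDr : right_distributive free_mul free_add.
Proof.
move=> a b c; have := class_ring_axiom (tnth [tuple a; b; c]) ax_mulDr.
by rewrite !subst_ringE !classE /= !(tnth_nth a) /= !classK.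
Qed.

HB.instance Definition _ := GRing.isPzRing.Build free_nring
  free_addA free_addC free_add0 free_addN
  free_mulA free_mul1l free_mul1r free_mulDl free_mulDr.

Lemma class_texp s k : class (texp s k) = class s ^+ k.
Proof.
case: k => // k; rewrite /texp /GRing.exp !iteropS.
by elim: k => // k IHk; rewrite !iterS class_mul IHk.
Qed.

Lemma class_tmuln s k : class (tmuln s k) = class s *+ k.
Proof.
case: k => // k; rewrite /tmuln GRing.mulrS !iteropS.
elim: k => [|k IHk]; first by rewrite addr0.
by rewrite !iterS class_add IHk mulrS.
Qed.

Lemma free_nring_exp (a : free_nring) : a ^+ n = a.
Proof.
have := class_axiom (fun=> repr a) (ax_exp n m).
by rewrite subst_texp class_texp /= classK.
Qed.

Lemma free_nring_char : m%:R = 0 :> free_nring.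
Proof.
have := class_axiom (fun i : 'I_0 => 0%RT : ring_term r) (ax_char n m).
by rewrite subst_tmuln class_tmuln subst_tone subst_tzero.
Qed.

End FreeRing.

Theorem theorem1p5 (p : nat) (hp : prime p) :
  provable (nring_theory (p ^ 2) p) ('x[2] * 'y[2])%RT ('y[2] * 'x[2])%RT.
Proof.
apply/classP; rewrite !class_mul.
move: (class _ _ _) (class _ _ _) => x y.
(* If the quotient is the zero ring, all classes agree; otherwise [1 != 0] provides the [nzRingType]
   structure. *)
have [one0 | one_neq0] := eqVneq (1 : free_nring (p ^ 2) p 2) 0.
  by rewrite -[LHS]mul1r -[RHS]mul1r one0 !mul0r.
pose R : nzRingType := HB.pack (free_nring (p ^ 2) p 2)
  (GRing.PzSemiRing_isNonZero.Build (free_nring (p ^ 2) p 2) one_neq0).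
have pcharRp : p \in [pchar R].
  by apply/andP; split=> //; apply/eqP; exact: free_nring_char.
exact: (pchar_exp_sqr_commutative pcharRp (@free_nring_exp _ _ _)).
Qed.
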